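(* Let $0<M<N$ be integers, let $(a_{ij})_{i,j=1}^N$ be a real matrix, let $g_i\in\mathbb{R}$ ($i=1,\dots,M$) and $u^b_i\in\mathbb{R}$ ($i=M+1,\dots,N$) be given, and assume that $$\sum_{i,j=1}^M v_i\,a_{ij}\,v_j>0\qquad\forall\,(v_1,\dots,v_M)\in\mathbb{R}^M\setminus\{0\}.$$ Let $\beta_{ij}:\mathbb{R}^N\to[0,1]$, $i,j=1,\dots,N$, be functions such that, for any $i,j\in\{1,\dots,N\}$ with $a_{ij}>0$, the function $\mathrm{U}=(u_1,\dots,u_N)\mapsto\beta_{ij}(\mathrm{U})(u_j-u_i)$ is continuous on $\mathbb{R}^N$. Define $$b_{ij}(\mathrm{U})=-\max\{\beta_{ij}(\mathrm{U})\,a_{ij},\,0,\,\beta_{ji}(\mathrm{U})\,a_{ji}\},\quad i\neq j,\qquad b_{ii}(\mathrm{U})=-\sum_{j\ne i}b_{ij}(\mathrm{U}),\qquad i,j=1,\dots,N.$$ Then, for any $i\in\{1,\dots,M\}$ and $j\in\{1,\dots,N\}$, the function $\mathrm{U}\mapsto b_{ij}(\mathrm{U})(u_j-u_i)$ is continuous on $\mathbb{R}^N$, and for any $i\in\{1,\dots,M\}$ and $j\in\{M+1,\dots,N\}$, the function $b_{ij}$ is bounded on $\mathbb{R}^N$. Moreover, there exists $\mathrm{U}=(u_1,\dots,u_N)\in\mathbb{R}^N$ such that $$\sum_{j=1}^N (a_{ij}+b_{ij}(\mathrm{U}))\,u_j=g_i,\quad i=1,\dots,M,\qquad u_i=u^b_i,\quad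 i=M+1,\dots,N.$$
   Context: The matrix $(a_{ij})$ is not assumed symmetric, and $\beta_{ij}=\beta_{ji}$ is not assumed. The functions $\beta_{ij}$ themselves are not assumed continuous. *)

(* Defs.v *)
From mathcomp Require Import all_boot all_order all_algebra.
From mathcomp Require Import all_classical all_reals all_analysis.

Set Implicit Arguments.
Unset Strict Implicit.
Unset Printing Implicit Defensive.

Import Order.TTheory GRing.Theory Num.Theory.
Import numFieldNormedType.Exports.

Local Open Scope ring_scope.

Definition b_offdiag (R : realType) (N : nat) (a : 'M[R]_N)
    (beta : 'I_N -> 'I_N -> 'rV[R]_N -> R) (U : 'rV[R]_N) (i j : 'I_N) : R :=
  - Num.max (beta i j U * a i j) (Num.max 0 (beta j i U * a j i)).

Definition b_coef (R : realType) (N : nat) (a : 'M[R]_N)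
    (beta : 'I_N -> 'I_N -> 'rV[R]_N -> R) (U : 'rV[R]_N) (i j : 'I_N) : R :=
  if i == j then - \sum_(k < N | k != i) b_offdiag a beta U i k
  else b_offdiag a beta U i j.

(* Main.v *)
(** The system for the first [M] unknowns reads [F v = 0] with [F] continuous.
    Since [b] is symmetric with nonpositive off-diagonal entries, the terms
    [b_ij (u_j - u_i)] with [i, j <= M] contribute a nonnegative amount to
    [<F v, v>], while the boundary terms contribute at worst linearly because
    [b] is bounded; so positive definiteness of [(a_ij)] makes [F] coercive.

    A coercive continuous map [F] on R^n has a zero. On a box containing the
    critical sphere, approximate [F] by a polynomial map [q] (Bernstein). For an
    odd [d] exceeding [deg q], the system [q_k x + eps x_k^d = 0] has a real
    solution: the quotient of R[x_1, ..., x_n] by these equations has the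
    monomials with all exponents [< d] as a basis, hence odd dimension [d^n], so
    that the commuting multiplications by the [x_k] have a common real
    eigenvector, whose eigenvalues form a solution. For large [d] the solution
    lies in the box, and compactness concludes as [eps] tends to [0]. *)

Require Import Defs.
From mathcomp Require Import all_boot all_order all_algebra.
From mathcomp Require Import all_classical all_reals all_analysis.
From mathcomp Require Import zify ring lra.
From mathcomp Require complex.

Set Implicit Arguments.
Unset Strict Implicit.
Unset Printing Implicit Defensive.

Import Order.TTheory GRing.Theory Num.Theory.
Import numFieldNormedType.Exports.

Local Open Scope ring_scope.

(** * Polynomial systems with pure leading terms of odd degree *)

Section Exponents.
Variable n : nat.
Implicit Types (m p : {ffun 'I_n -> nat}) (i : 'I_n).

Definition expo_deg m : nat := (\sum_i m i)%N.
Definition expo_add m p := [ffun k => (m k + p k)%N].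
Definition expo_single e i := [ffun k : 'I_n => (e * (k == i))%N].
(** Exponent of the quotient by [x_i^d]. The subtraction is truncated, so this reading is valid only
    when [d <= m i]. *)
Definition expo_sub d m i := [ffun k => (m k - d * (k == i))%N].

Lemma expo_degD m p : expo_deg (expo_add m p) = (expo_deg m + expo_deg p)%N.
Proof. by rewrite /expo_deg -big_split; apply: eq_bigr => i _; rewrite ffunE. Qed.

Lemma expo_deg_single e i : expo_deg (expo_single e i) = e.
Proof.
rewrite /expo_deg (bigD1 i) //= ffunE eqxx muln1 big1 ?addn0 // => k /negPf ki.
by rewrite ffunE ki muln0.
Qed.

Lemma expo_subK d m i : (d <= m i)%N -> expo_add (expo_sub d m i) (expo_single d i) = m.
Proof.
move=> h; apply/ffunP => k; rewrite !ffunE.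
by case: eqP => [->|_]; rewrite ?muln1 ?muln0 ?subn0 ?addn0 ?subnK.
Qed.

Lemma expo_deg_sub d m i : (d <= m i)%N ->
  expo_deg m = (expo_deg (expo_sub d m i) + d)%N.
Proof. by move=> h; rewrite -{1}(expo_subK h) expo_degD expo_deg_single. Qed.

End Exponents.

Section OddSystem.
Variables (R : rcfType) (n d' : nat).
Local Notation d := d'.+1.
Local Notation expo := {ffun 'I_n -> nat}.
(** [r i] lists the terms (coefficient, exponent) of the lower-degree part of the [i]-th equation,
    whose leading term is [x_i^d]. The [D] standard monomials [mon s] have all exponents below
    [d]. *)
Variable (r : 'I_n -> seq (R * expo)).
Implicit Types (m p : expo) (i j : 'I_n).
Let D := #|{ffun 'I_n -> 'I_d}|.
Let std m : {ffun 'I_n -> 'I_d} := [ffun i => inord (m i)].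
Let mon (s : 'I_D) : expo := [ffun i => nat_of_ord (enum_val s i)].

Hypothesis hr : forall i (t : R * expo), t \in r i -> (expo_deg t.2 < d)%N.

Lemma expo_deg_reduce m i j (t : R * expo) :
  (d <= m i)%N -> t \in r j ->
  (expo_deg (expo_add (expo_sub d m i) t.2) < expo_deg m)%N.
Proof. by move=> hi ht; rewrite expo_degD (expo_deg_sub hi) ltn_add2l (hr ht). Qed.

(** Coordinates, in the standard monomials, of the class of the monomial [m] in the quotient,
    obtained by the rewriting [x_i^d -> - r_i]. The fuel [k] makes the recursion structural; 0 is
    returned when it runs out. *)
Fixpoint nf_rec (k : nat) m : 'cV[R]_D :=
  if [pick i | (d <= m i)%N] is Some i then
    if k is k'.+1 then
      - \sum_(t <- r i) t.1 *: nf_rec k' (expo_add (expo_sub d m i) t.2)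
    else 0
  else delta_mx (enum_rank (std m)) 0.

Definition nf m := nf_rec (expo_deg m).+1 m.

(** Each rewriting strictly lowers the total degree, so fuel above the degree never runs out. *)
Lemma nf_rec_stable k m : (expo_deg m < k)%N -> nf_rec k m = nf m.
Proof.
rewrite /nf; move: {2}(expo_deg m) (leqnn (expo_deg m)) => w.
elim: w k m => [|w IH] [|k] m // hw hk /=; case: pickP => // i hi;
  have hs := expo_deg_sub hi; first lia.
congr (- _); apply: eq_big_seq => t ht; congr (_ *: _).
have hlt : (expo_deg (expo_add (expo_sub d m i) t.2) < expo_deg m)%N.
  exact: expo_deg_reduce hi ht.
rewrite IH; [|exact: leq_trans hlt hw|exact: leq_trans hlt hk].
symmetry; case: (expo_deg m) hlt hw => [//|w'] hlt hw.
by apply: IH => //; apply: leq_trans hlt hw.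
Qed.

Lemma nf_pick m i : [pick i | (d <= m i)%N] = Some i ->
  nf m = - \sum_(t <- r i) t.1 *: nf (expo_add (expo_sub d m i) t.2).
Proof.
move=> hp; rewrite {1}/nf /= hp; congr (- _); apply: eq_big_seq => t ht.
have hi : (d <= m i)%N by move: hp; case: pickP => // ? ? [<-].
congr (_ *: _); apply: nf_rec_stable.
exact: expo_deg_reduce hi ht.
Qed.

Lemma nf_std m : (forall i, (m i < d)%N) -> nf m = delta_mx (enum_rank (std m)) 0.
Proof.
by move=> hm; rewrite /nf /=; case: pickP => // i; rewrite leqNgt hm.
Qed.

Lemma nf_mon s : nf (mon s) = delta_mx s 0.
Proof.
rewrite nf_std => [|i]; last by rewrite ffunE.
congr delta_mx; apply: enum_val_inj; rewrite enum_rankK.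
by apply/ffunP => i; rewrite !ffunE inord_val.
Qed.

(* Since the leading monomials x_i^d are pairwise coprime, reducing along i
   and then j agrees with reducing along j and then i. *)
Lemma nf_reduce m j :
  nf (expo_add m (expo_single d j)) = - \sum_(t <- r j) t.1 *: nf (expo_add m t.2).
Proof.
move: {2}(expo_deg m) (leqnn (expo_deg m)) => w.
elim/ltn_ind: w m j => w IH m j hw.
case hp : [pick i | (d <= expo_add m (expo_single d j) i)%N] => [i|]; last first.
  by move: hp; case: pickP => // /(_ j); rewrite !ffunE eqxx muln1 leq_addl.
have hi : (d <= expo_add m (expo_single d j) i)%N.
  by move: hp; case: pickP => // ? ? [<-].
rewrite (nf_pick hp); have [eij|nij] := eqVneq i j.
  rewrite eij; congr (- _); apply: eq_bigr => t _; congr (_ *: nf (expo_add _ _)).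
  by apply/ffunP => k; rewrite !ffunE addnK.
have hmi : (d <= m i)%N.
  by move: hi; rewrite !ffunE (negPf nij) muln0 addn0.
have hlt t i' : t \in r i' -> (expo_deg (expo_add (expo_sub d m i) t.2) < expo_deg m)%N.
  exact: expo_deg_reduce.
(* As [i != j], [x_i^d] divides [m] itself. The induction hypothesis reduces the remaining [x_j^d]
   on the left and, further down, [x_i^d] on the right; both sides become the same double sum. *)
have -> : \sum_(t <- r i)
      t.1 *: nf (expo_add (expo_sub d (expo_add m (expo_single d j)) i) t.2) =
    - \sum_(t <- r i) \sum_(s <- r j)
        (t.1 * s.1) *: nf (expo_add (expo_add (expo_sub d m i) t.2) s.2).
  rewrite -sumrN; apply: eq_big_seq => t ht.
  have -> : expo_add (expo_sub d (expo_add m (expo_single d j)) i) t.2 =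
            expo_add (expo_add (expo_sub d m i) t.2) (expo_single d j).
    apply/ffunP => k; rewrite !ffunE.
    by case: (eqVneq k i) => [->|_]; rewrite ?(negPf nij); lia.
  rewrite (IH (expo_deg (expo_add (expo_sub d m i) t.2))) ?(leq_trans (hlt _ _ ht)) //.
  by rewrite scalerN scaler_sumr; congr (- _); apply: eq_bigr => s _; rewrite scalerA.
congr (- _).
have -> : \sum_(s <- r j) s.1 *: nf (expo_add m s.2) =
    - \sum_(s <- r j) \sum_(t <- r i)
        (t.1 * s.1) *: nf (expo_add (expo_add (expo_sub d m i) t.2) s.2).
  rewrite -sumrN; apply: eq_big_seq => s hs.
  have -> : expo_add m s.2 = expo_add (expo_add (expo_sub d m i) s.2) (expo_single d i).
    by rewrite -{1}(expo_subK hmi); apply/ffunP => k; rewrite !ffunE; lia.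
  rewrite (IH (expo_deg (expo_add (expo_sub d m i) s.2))) ?(leq_trans (hlt _ _ hs)) //.
  rewrite scalerN scaler_sumr; congr (- _); apply: eq_bigr => t _.
  rewrite scalerA mulrC; congr (_ *: nf _).
  by apply/ffunP => k; rewrite !ffunE addnAC.
by rewrite exchange_big.
Qed.

(** The matrix of multiplication by [x_i] on the quotient. *)
Let X i : 'M[R]_D := \matrix_(p, q) nf (expo_add (mon q) (expo_single 1 i)) p 0.

(** Confluence makes multiplication well defined: if [x_j^d] divides [m], then [nf_reduce] allows
    [x_i m] to be reduced along the same [j], whichever index [nf] would pick. *)
Lemma mulX_nf i m : X i *m nf m = nf (expo_add m (expo_single 1 i)).
Proof.
move: {2}(expo_deg m) (leqnn (expo_deg m)) => w.
elim/ltn_ind: w m => w IH m hw.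
case hp : [pick i | (d <= m i)%N] => [j|]; last first.
  have hm k : (m k < d)%N.
    by move: hp; case: pickP => // /(_ k)/negbT; rewrite -leqNgt.
  rewrite (nf_std hm); set s := enum_rank _.
  have -> : m = mon s.
    by apply/ffunP => k; rewrite ffunE /s enum_rankK ffunE inordK.
  apply/matrixP => p q; rewrite mxE (bigD1 s) //= !mxE eqxx ord1 /= mulr1.
  by rewrite big1 ?addr0 // => k /negPf ks; rewrite !mxE ks mulr0.
have hj : (d <= m j)%N by move: hp; case: pickP => // ? ? [<-].
rewrite (nf_pick hp) mulmxN mulmx_sumr.
have -> : expo_add m (expo_single 1 i) =
    expo_add (expo_add (expo_sub d m j) (expo_single 1 i)) (expo_single d j).
  by rewrite -{1}(expo_subK hj); apply/ffunP => k; rewrite !ffunE; lia.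
rewrite nf_reduce; congr (- _); apply: eq_big_seq => t ht.
rewrite -scalemxAr (IH (expo_deg (expo_add (expo_sub d m j) t.2))) //; last first.
  exact: leq_trans (expo_deg_reduce hj ht) hw.
by congr (_ *: nf _); apply/ffunP => k; rewrite !ffunE addnAC.
Qed.

Lemma mulX_comm i j : X i *m X j = X j *m X i.
Proof.
apply/trmx_inj/row_matrixP => s; rewrite -!tr_col !colE -!mulmxA -nf_mon !mulX_nf.
by congr (nf _)^T; apply/ffunP => k; rewrite !ffunE addnAC.
Qed.

(** A common row eigenvector [v] of the [X i] is a linear form on the quotient that turns
    multiplication by [x_i] into scaling by the eigenvalue [x i]. It is therefore a multiple of
    evaluation at the point [x], and evaluation respects the equations. *)
Lemma odd_system_root : odd d -> exists x : 'I_n -> R,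
  forall i, x i ^+ d + \sum_(t <- r i) t.1 * \prod_k x k ^+ t.2 k = 0.
Proof.
move=> dodd; case: (posnP n) => [n0|npos].
  by exists (fun=> 0) => -[i hi]; exfalso; rewrite n0 in hi.
have oddD : ~~ (2 %| \rank (1%:M : 'M[R]_D))%N.
  by rewrite mxrank1 dvdn2 negbK /D card_ffun !card_ord oddX dodd orbT.
(* Over a real closed field, finitely many commuting endomorphisms of an odd-dimensional space have
   a common eigenvector. *)
have [//|||v v0 hv] := (@complex.Lemma4 R n.-1 D 1%:M oddD [seq X i | i <- enum 'I_n]).
- by rewrite size_map size_enum_ord prednK.
- by move=> f _; rewrite submx1.
- by move=> f h /mapP[i _ ->] /mapP[j _ ->]; apply: mulX_comm.
have {}hv i : exists c, v *m X i = c *: v.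
  have [|c hc] := hv (X i); first by apply: map_f; rewrite mem_enum.
  by exists c; apply/eigenspaceP.
have [x hx] : exists x : 'I_n -> R, forall i, v *m X i = x i *: v.
  by apply: (@fin_all_exists _ (fun=> R) (fun i c => v *m X i = c *: v)) hv.
pose ev m := (v *m nf m) 0 0.
have evD m i e : ev (expo_add m (expo_single e i)) = x i ^+ e * ev m.
  elim: e => [|e IH].
    rewrite expr0 mul1r; congr ((v *m nf _) 0 0).
    by apply/ffunP => k; rewrite !ffunE mul0n addn0.
  have -> : expo_add m (expo_single e.+1 i) =
      expo_add (expo_add m (expo_single e i)) (expo_single 1 i).
    by apply/ffunP => k; rewrite !ffunE; lia.
  by rewrite {1}/ev -mulX_nf mulmxA hx -scalemxAl mxE -/(ev _) IH mulrA -exprS.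
pose m0 : expo := [ffun=> 0%N].
have evE m : ev m = (\prod_k x k ^+ m k) * ev m0.
  have H (s : seq 'I_n) : uniq s ->
      ev [ffun k => if k \in s then m k else 0%N] = (\prod_(k <- s) x k ^+ m k) * ev m0.
    elim: s => [|k s IH] /=.
      rewrite big_nil mul1r => _; apply: (congr1 ev).
      by apply/ffunP => i; rewrite !ffunE.
    move=> /andP[ks us]; rewrite big_cons -mulrA -IH // -evD; apply: (congr1 ev).
    apply/ffunP => i; rewrite !ffunE in_cons.
    by case: eqVneq => [->|_] /=; rewrite ?(negPf ks); lia.
  have := H (enum 'I_n) (enum_uniq _); rewrite big_enum /= => <-.
  by apply: (congr1 ev); apply/ffunP => i; rewrite ffunE mem_enum.
(* If the form vanished at the monomial 1, it would vanish at every standard monomial; these values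
   are the entries of [v]. *)
have ev0 : ev m0 != 0.
  apply: contra v0 => /eqP e0; apply/eqP/rowP => s.
  by rewrite !mxE; have := evE (mon s); rewrite e0 mulr0 /ev nf_mon -colE mxE.
exists x => i; apply: (mulIf ev0); rewrite mul0r mulrDl -evD mulr_suml.
have -> : ev (expo_add m0 (expo_single d i)) = - \sum_(t <- r i) t.1 * ev t.2.
  rewrite /ev nf_reduce mulmxN mulmx_sumr mxE summxE; congr (- _).
  apply: eq_bigr => t _; rewrite -scalemxAr mxE; congr (_ * (v *m nf _) 0 0).
  by apply/ffunP => k; rewrite !ffunE.
apply/eqP; rewrite addrC subr_eq0; apply/eqP.
by apply: eq_bigr => t _; rewrite (evE t.2) mulrA.
Qed.

End OddSystem.

(** * Polynomial approximation on a box *)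

Definition box (R : realType) n (L : R) : set 'rV[R]_n :=
  [set x | forall k, -L <= x 0 k <= L]%classic.

Lemma box_compact (R : realType) n (L : R) : compact (@box R n L).
Proof.
have := @rV_compact R n (fun=> `[-L, L]%classic) (fun=> @segment_compact R _ _).
by congr compact; apply/seteqP; split => x hx k; have := hx k; rewrite /= in_itv.
Qed.

(* Uniform continuity on the box, with a quadratic error term so that averaging
   over [z] bounds it by a variance. *)
Lemma box_modulus (R : realType) n (f : 'rV[R]_n -> R) (L eps : R) :
  continuous f -> 0 < eps -> exists2 C, 0 <= C & forall x z, box L x -> box L z ->
    `|f z - f x| <= eps + C * \sum_k (z 0 k - x 0 k) ^+ 2.
Proof.
move=> cf e0.
have [K0|] := pselect ((@box R n L) !=set0)%classic; last first.
  by move=> h; exists 0 => // x z bx; case: h; exists x.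
have [c _ hB] : exists2 c : 'rV[R]_n, c \in box L &
    forall t, t \in box L -> `|f t| <= `|f c|.
  apply: (@EVT_max_rV R n (fun t => `|f t|)) => //; first exact: box_compact.
  apply: continuous_subspaceT => x.
  by apply: continuous_comp; [exact: cf|exact: norm_continuous].
pose P (dl : R) (x : 'rV[R]_n) :=
  forall z : 'rV[R]_n, (forall k, `|z 0 k - x 0 k| < dl) -> `|f z - f x| < eps.
(* Compactness in its near-covering form gives one [dl] for all points of the box. *)
have : \forall dl \near (0 : R)^'+%classic, (box L `<=` P dl)%classic.
  apply: (proj1 (compact_near_coveringP _) (@box_compact R n L)) => x0 _.
  have /cvgrPdist_lt/(_ (eps / 2)) := cf x0.
  rewrite divr_gt0 // => /(_ isT)/nbhs_ballP[r /= r0 hr].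
  near=> x dl; rewrite /P => z hz.
  have hx : ball x0 (r / 2) x.
    by near: x; apply: nbhsx_ballx; rewrite divr_gt0.
  have hdl : dl < r / 2.
    by near: dl; apply: nbhs_right_lt; rewrite divr_gt0.
  have h1 : `|f x0 - f x| < eps / 2.
    by apply: hr; apply: le_ball hx; rewrite ler_pdivrMr //; lra.
  have h2 : `|f x0 - f z| < eps / 2.
    apply: hr; split=> // i j; have [_ /(_ i j)] := hx; have := hz j.
    by rewrite /ball /= ord1 !ltr_distl => /andP[? ?] /andP[? ?]; apply/andP; split; lra.
  by move: h1 h2; rewrite !ltr_norml => /andP[? ?] /andP[? ?]; apply/andP; split; lra.
move=> hP; have [dl [/= hdl d0]] : exists dl, (box L `<=` P dl)%classic /\ 0 < dl.
  apply: (@filter_ex _ (0 : R)^'+%classic); apply: filterI hP _; exact: nbhs_right_gt.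
(* When some coordinates differ by at least [dl], the sum of squares is at least [dl^2], so the [C]
   term alone exceeds twice the maximum of [|f|]. *)
exists (2 * `|f c| / dl ^+ 2); first by rewrite divr_ge0 ?sqr_ge0 ?mulr_ge0.
move=> x z bx bz.
have S0 : 0 <= \sum_k (z 0 k - x 0 k) ^+ 2 by apply: sumr_ge0 => k _; apply: sqr_ge0.
have [hk|] := pselect (forall k, `|z 0 k - x 0 k| < dl).
  apply: (le_trans (ltW (hdl x bx z hk))); rewrite lerDl.
  by rewrite mulr_ge0 // divr_ge0 ?sqr_ge0 ?mulr_ge0.
move=> /existsNP[k /negP]; rewrite -leNgt => hk.
have hS : dl ^+ 2 <= \sum_k (z 0 k - x 0 k) ^+ 2.
  apply: (@le_trans _ _ (`|z 0 k - x 0 k| ^+ 2)).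
    by rewrite ler_pXn2r ?nnegrE ?(ltW d0).
  rewrite real_normK ?num_real // (bigD1 k) //= lerDl.
  by apply: sumr_ge0 => i _; apply: sqr_ge0.
have : 2 * `|f c| <= 2 * `|f c| / dl ^+ 2 * \sum_k (z 0 k - x 0 k) ^+ 2.
  by rewrite -mulrA ler_peMr ?mulr_ge0 // ler_pdivlMl ?exprn_gt0 // mulr1.
have := hB x; have := hB z; rewrite !inE => /(_ bz) ? /(_ bx) ?.
have := ler_normB (f z) (f x); lra.
Unshelve. all: by end_near.
Qed.

Section PolynomialFunctions.
Variables (R : comNzRingType) (n : nat).
Implicit Types (p q : seq (R * {ffun 'I_n -> nat})) (x : 'rV[R]_n).

Definition peval p x := \sum_(t <- p) t.1 * \prod_k x 0 k ^+ t.2 k.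

Definition polyfun (f : 'rV[R]_n -> R) := exists p, forall x, f x = peval p x.

Lemma polyfun_cst c : polyfun (fun=> c).
Proof.
exists [:: (c, [ffun=> 0%N])] => x; rewrite /peval big_seq1 /= big1 ?mulr1 //.
by move=> k _; rewrite ffunE.
Qed.

Lemma polyfun_coord k : polyfun (fun x => x 0 k).
Proof.
exists [:: (1, expo_single 1 k)] => x; rewrite /peval big_seq1 /= mul1r.
rewrite (bigD1 k) //= big1 ?mulr1; first by rewrite ffunE eqxx.
by move=> j /negPf jk; rewrite ffunE jk.
Qed.

Lemma polyfunD f g : polyfun f -> polyfun g -> polyfun (fun x => f x + g x).
Proof.
by move=> [p hp] [q hq]; exists (p ++ q) => x; rewrite hp hq /peval big_cat.
Qed.

Lemma polyfunM f g : polyfun f -> polyfun g -> polyfun (fun x => f x * g x).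
Proof.
move=> [p hp] [q hq]; exists [seq (t.1 * s.1, expo_add t.2 s.2) | t <- p, s <- q] => x.
rewrite hp hq /peval big_allpairs_dep mulr_suml; apply: eq_bigr => t _.
rewrite mulr_sumr; apply: eq_bigr => s _ /=; rewrite mulrACA -big_split /=.
by congr (_ * _); apply: eq_bigr => k _; rewrite ffunE exprD.
Qed.

End PolynomialFunctions.

Section Bernstein.
Variables (R : realFieldType) (n : nat).
Implicit Types (w : 'I_n -> R) (h : R) (s : seq 'I_n) (g : 'rV[R]_n -> R).
Implicit Types (a x : 'rV[R]_n).

(* The mean of [g] at the end of a random walk started at [a], the [i]-th step
   of which is [h] in the direction [k := s_i] with probability [w k], and void
   otherwise. *)
Fixpoint bernstein w h s g a : R :=
  if s is k :: s' then
    w k * bernstein w h s' g (a + h *: delta_mx 0 k) +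
    (1 - w k) * bernstein w h s' g a
  else g a.

(** Each step is a convex combination, so the triangle inequality passes through the mean. *)
Lemma bernstein_dist w h s g q c a : (forall k, 0 <= w k <= 1) ->
  (forall z, `|g z - c| <= q z) ->
  `|bernstein w h s g a - c| <= bernstein w h s q a.
Proof.
move=> hw hq; elim: s a => [|k s IH] a //=.
set u := bernstein _ _ _ g _; set v := bernstein _ _ _ g a.
have -> : w k * u + (1 - w k) * v - c = w k * (u - c) + (1 - w k) * (v - c) by ring.
have /andP[w0 w1] := hw k.
apply: (le_trans (ler_normD _ _)); rewrite !normrM (ger0_norm w0).
rewrite (@ger0_norm _ (1 - w k)) ?subr_ge0 //.
by apply: lerD; apply: ler_wpM2l; rewrite ?subr_ge0 ?IH.
Qed.

Lemma bernstein_affine w h s b C (q : 'I_n -> 'rV[R]_n -> R) a :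
  bernstein w h s (fun z => b + C * \sum_k q k z) a =
  b + C * \sum_k bernstein w h s (q k) a.
Proof.
elim: s a => [//|k s IH] a /=; rewrite !IH big_split /= -!mulr_sumr; ring.
Qed.

(** Variance plus squared bias: the [k]-th coordinate of the endpoint is [a_k] plus [h] times a
    binomial variable with [count_mem k s] trials of probability [w k]. *)
Lemma bernstein_variance w h s c k a :
  bernstein w h s (fun z => (z 0 k - c) ^+ 2) a =
  h ^+ 2 * (count_mem k s)%:R * (w k * (1 - w k)) +
  (a 0 k + h * (count_mem k s)%:R * w k - c) ^+ 2.
Proof.
elim: s a => [|j s IH] a /=; first by rewrite !(mulr0, mul0r) add0r addr0.
rewrite !IH !mxE eqxx /= (eq_sym j) natrD; case: eqVneq => [<-|_] /=; ring.
Qed.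

(** Only the probabilities depend on [x]; [g] is evaluated at fixed grid points. *)
Lemma polyfun_bernstein (w : 'I_n -> 'rV[R]_n -> R) h s g a :
  (forall k, polyfun (w k)) -> polyfun (fun x => bernstein (w^~ x) h s g a).
Proof.
move=> hw; elim: s a => [|k s IH] a /=; first exact: polyfun_cst.
apply: polyfunD; apply: polyfunM => //.
apply: polyfunD; first exact: polyfun_cst.
have -> : (fun x => - w k x) = (fun x => -1 * w k x).
  by apply/funext => x; rewrite mulN1r.
by apply: polyfunM => //; apply: polyfun_cst.
Qed.

End Bernstein.

(** A walk from the corner [-L] with [m] steps of length [2L/m] per direction, taken with
    probability [(x_k + L)/(2L)], has mean [x] and variance at most [L^2/m] per coordinate. By
    [box_modulus] the error is at most [eps/2 + C n L^2/m]. *)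
Lemma weierstrass_box (R : realType) n (f : 'rV[R]_n -> R) (L eps : R) :
  continuous f -> 0 < L -> 0 < eps -> exists p,
  forall x, box L x -> `|peval p x - f x| <= eps.
Proof.
move=> cf L0 e0; have e2 : 0 < eps / 2 by rewrite divr_gt0.
have [C C0 hC] := box_modulus L cf e2.
(* [bernstein_dist] needs a bound at every [z], [box_modulus] gives one on the box. Clamping brings
   no coordinate farther from a point of the box. *)
pose clamp (z : 'rV[R]_n) : 'rV[R]_n := \row_k Num.max (- L) (Num.min L (z 0 k)).
have clamp_box z : box L (clamp z).
  by move=> k; rewrite mxE le_max lexx /= ge_max ge_min lexx /= andbT; lra.
(* For [m > A] the term [C n L^2/m] is at most [eps/2]. *)
pose A := 2 * C * n%:R * L ^+ 2 / eps.
have A0 : 0 <= A by rewrite !(mulr_ge0, divr_ge0, sqr_ge0) // ?invr_ge0 ltW.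
pose m := (Num.trunc A).+1.
have hm : A < m%:R by apply: truncnS_gt.
have m0 : 0 < m%:R :> R by rewrite ltr0n.
pose s := flatten (nseq m (enum 'I_n)).
have hs k : count_mem k s = m.
  rewrite /s count_flatten map_nseq sumn_nseq.
  by rewrite count_uniq_mem ?enum_uniq // mem_enum mul1n.
pose w k (x : 'rV[R]_n) := (x 0 k + L) * (2 * L)^-1.
have [|p hp] := @polyfun_bernstein R n w (2 * L / m%:R) s (f \o clamp) (const_mx (- L)).
  move=> k; apply: polyfunM (polyfun_cst _ _).
  by apply: polyfunD (polyfun_cst _ _); apply: polyfun_coord.
exists p => x bx; rewrite -hp.
have hw k : 0 <= w k x <= 1.
  have /andP[h1 h2] := bx k; rewrite /w; apply/andP; split.
    by apply: divr_ge0; lra.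
  by rewrite ler_pdivrMr; lra.
apply: (@le_trans _ _ (bernstein (w^~ x) (2 * L / m%:R) s
    (fun z => eps / 2 + C * \sum_k (z 0 k - x 0 k) ^+ 2) (const_mx (- L)))).
  apply: bernstein_dist => // z /=; apply: (le_trans (hC x _ bx (clamp_box z))).
  rewrite lerD2l ler_wpM2l // ler_sum // => k _; rewrite mxE.
  have /andP[h1 h2] := bx k.
  rewrite maxEle minEle; case: (leP L); case: (leP (- L)) => *; nra.
rewrite (@bernstein_affine _ _ _ _ _ _ _ (fun k z => (z 0 k - x 0 k) ^+ 2)).
under eq_bigr => k _ do rewrite bernstein_variance hs mxE.
rewrite [X in _ <= X](_ : eps = eps / 2 + eps / 2); last by lra.
rewrite lerD2l.
have hk k : (2 * L / m%:R) ^+ 2 * m%:R * (w k x * (1 - w k x)) +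
    (- L + 2 * L / m%:R * m%:R * w k x - x 0 k) ^+ 2 <= L ^+ 2 / m%:R.
  have -> : - L + 2 * L / m%:R * m%:R * w k x - x 0 k = 0.
    by rewrite /w; field; rewrite !gt_eqF.
  have -> : (2 * L / m%:R) ^+ 2 * m%:R = 4 * (L ^+ 2 / m%:R) by field; rewrite gt_eqF.
  rewrite expr0n addr0.
  have : 0 <= L ^+ 2 / m%:R by rewrite divr_ge0 ?sqr_ge0 ?(ltW m0).
  have := sqr_ge0 (2 * w k x - 1); nra.
apply: (@le_trans _ _ (C * \sum_(k < n) (L ^+ 2 / m%:R))).
  by rewrite ler_wpM2l // ler_sum.
rewrite sumr_const card_ord -[_ *+ n]mulr_natr.
have -> : C * (L ^+ 2 / m%:R * n%:R) = (A * eps / 2) / m%:R.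
  by rewrite /A; field; rewrite !gt_eqF.
rewrite ler_pdivrMr //; nra.
Qed.

(** * Zeros of coercive maps *)

Lemma peval_growth (R : realFieldType) n (p : seq (R * {ffun 'I_n -> nat})) d c
    (x : 'rV[R]_n) : (forall t, t \in p -> (expo_deg t.2 <= d)%N) -> 1 <= c ->
  (forall k, `|x 0 k| <= c) -> `|peval p x| <= (\sum_(t <- p) `|t.1|) * c ^+ d.
Proof.
move=> hp c1 hx; rewrite /peval mulr_suml.
apply: (le_trans (ler_norm_sum _ _ _)).
rewrite big_seq [X in _ <= X]big_seq; apply: ler_sum => t ht.
rewrite normrM ler_wpM2l // normr_prod; apply: (@le_trans _ _ (c ^+ expo_deg t.2)).
  rewrite -prodrXr; apply: ler_prod => k _; rewrite normr_ge0 /= normrX.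
  by rewrite lerXn2r ?nnegrE // (le_trans ler01).
exact/ler_weXn2l/hp.
Qed.

(** Division by [dl] gives an odd system. If the largest coordinate of its root had modulus [c > 2],
    the term [dl c^(2d+1)] would exceed the bound [S c^D] on the polynomial part. *)
Lemma perturbed_root (R : realType) n (q : 'I_n -> seq (R * {ffun 'I_n -> nat}))
    (dl : R) : 0 < dl ->
  exists d, exists2 x, box 2 x & forall k, peval (q k) x + dl * x 0 k ^+ (d.*2.+1) = 0.
Proof.
move=> dl0.
pose D := (\max_k \max_(t <- q k) expo_deg t.2)%N.
have hD k t : t \in q k -> (expo_deg t.2 <= D)%N.
  move=> ht; apply: leq_trans (leq_bigmax k).
  by rewrite (big_rem t) //= leq_maxl.
pose S := \sum_k \sum_(t <- q k) `|t.1|.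
have hS k : \sum_(t <- q k) `|t.1| <= S.
  rewrite /S (bigD1 k) //= lerDl.
  by do 2![apply: sumr_ge0 => ? _].
have S0 : 0 <= S by do 2![apply: sumr_ge0 => ? _].
(* With [d = D + e] the surplus exponent is [D + 2e + 1], and [2^(D+2e+1) >= e > S/dl]. *)
pose e := (Num.trunc (S / dl)).+1.
have he : S < e%:R * dl by rewrite -ltr_pdivrMr //; apply: truncnS_gt.
pose d := (D + e)%N.
pose r k := [seq (dl^-1 * t.1, t.2) | t <- q k].
have [||y hy] := @odd_system_root R n d.*2 r.
- move=> k t /mapP[u hu ->] /=; rewrite ltnS (leq_trans (hD _ _ hu)) //.
  by rewrite /d -addnn; lia.
- by rewrite /= odd_double.
pose x : 'rV[R]_n := \row_k y k.
have hx k : peval (q k) x + dl * x 0 k ^+ (d.*2.+1) = 0.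
  have -> : peval (q k) x = dl * \sum_(t <- r k) t.1 * \prod_i y i ^+ t.2 i.
    rewrite big_map mulr_sumr; apply: eq_bigr => t _ /=.
    rewrite !mulrA divff ?gt_eqF // mul1r; congr (_ * _).
    by apply: eq_bigr => i _; rewrite mxE.
  by rewrite mxE -mulrDr addrC hy mulr0.
exists d, x => // i; rewrite -ler_norml leNgt; apply/negP => hi.
pose j := [arg max_(k > i) `|x 0 k|]%O.
have hj k : `|x 0 k| <= `|x 0 j| by rewrite /j; case: arg_maxP => // c _; apply.
have j2 : 2 < `|x 0 j| by apply: lt_le_trans (hj i).
have j1 : 1 <= `|x 0 j| by lra.
have := peval_growth (hD j) j1 hj.
have /eqP := hx j; rewrite addr_eq0 => /eqP ->.
rewrite normrN normrM normrX gtr0_norm //.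
have -> : (d.*2.+1 = (D + e + e).+1 + D)%N by rewrite /d; lia.
rewrite exprD mulrA ler_pM2r ?exprn_gt0 ?(lt_le_trans ltr01) // => h.
have h2 : e%:R <= `|x 0 j| ^+ (D + e + e).+1.
  apply: (@le_trans _ _ (2 ^+ (D + e + e).+1)).
    rewrite -natrX ler_nat; apply: (leq_trans _ (ltnW (ltn_expl _ (ltnSn 1)))); lia.
  by rewrite lerXn2r ?nnegrE // ltW.
have := hS j; have : e%:R * dl <= dl * `|x 0 j| ^+ (D + e + e).+1.
  by rewrite mulrC ler_pM2l.
lra.
Qed.

Lemma compact_pos_lb (R : realType) n (f : 'rV[R]_n -> R) (K : set 'rV[R]_n) :
  compact K -> continuous f -> (forall x, K x -> 0 < f x) ->
  exists2 mu, 0 < mu & forall x, K x -> mu <= f x.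
Proof.
move=> cK cf fpos; have [K0|] := pselect (K !=set0)%classic; last first.
  by move=> h; exists 1 => // x Kx; case: h; exists x.
have [c cK' hc] := EVT_min_rV K0 cK (continuous_subspaceT cf).
exists (f c); first by apply: fpos; rewrite inE in cK'.
by move=> x Kx; apply: hc; rewrite inE.
Qed.

Lemma continuous_sum_fun (R : realType) (T : topologicalType) (I : Type)
    (s : seq I) (P : pred I) (f : I -> T -> R) :
  (forall i, continuous (f i)) -> continuous (fun x => \sum_(i <- s | P i) f i x).
Proof.
move=> cf; elim: s => [|i s IH].
  under eq_fun do rewrite big_nil; exact: cst_continuous.
under eq_fun do rewrite big_cons; case: (P i) => // x.
by apply: continuousD; [exact: cf|exact: IH].
Qed.

(** Without a zero, [sum |F_k|] has a positive lower bound on the box, and [<F x, x>] has one on the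
    part of the box where [|x| >= 1]. A root of the perturbed approximation violates one of the
    two. *)
Lemma coercive_zero_unit (R : realType) n (F : 'I_n -> 'rV[R]_n -> R) :
  (forall k, continuous (F k)) ->
  (forall x : 'rV[R]_n, 1 <= \sum_k x 0 k ^+ 2 -> 0 < \sum_k F k x * x 0 k) ->
  exists x, forall k, F k x = 0.
Proof.
move=> cF hF; apply: contrapT => hno.
have cX k : continuous (fun x : 'rV[R]_n => x 0 k) by move=> x; apply: coord_continuous.
have cN : continuous (fun x : 'rV[R]_n => \sum_k x 0 k ^+ 2).
  by apply: continuous_sum_fun => k x; exact: (continuousM (cX k x) (cX k x)).
have cP : continuous (fun x => \sum_k F k x * x 0 k).
  by apply: continuous_sum_fun => k x; apply: continuousM; [apply: cF|apply: cX].
have cQ : continuous (fun x => \sum_k `|F k x|).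
  apply: continuous_sum_fun => k x.
  by apply: continuous_comp; [exact: cF|exact: norm_continuous].
have [m1 m10 h1] : exists2 mu, 0 < mu & forall x, box 2 x -> mu <= \sum_k `|F k x|.
  apply: compact_pos_lb => //; first exact: box_compact.
  move=> x _; rewrite lt_neqAle sumr_ge0 // andbT eq_sym psumr_eq0 //.
  apply/negP => /allP h; apply: hno; exists x => k.
  by apply/eqP; rewrite -normr_eq0; apply: h; rewrite mem_index_enum.
have [m2 m20 h2] : exists2 mu, 0 < mu & forall x,
    (box 2 `&` [set x | 1 <= \sum_k x 0 k ^+ 2])%classic x ->
    mu <= \sum_k F k x * x 0 k.
  apply: compact_pos_lb => // [|x [_ /hF]] //.
  apply: compact_closedI; first exact: box_compact.
  apply: (@closed_comp _ _ (fun x : 'rV[R]_n => \sum_k x 0 k ^+ 2)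
    [set y | 1 <= y]%classic).
    by move=> x _; apply: cN.
  exact: closed_ge.
pose mu := Num.min m1 m2.
have mu0 : 0 < mu by rewrite lt_min m10.
(* [eps] serves both as approximation error and as perturbation coefficient; the total error
   [2 n eps] stays below [mu], also for [n = 0]. *)
pose eps := mu / (2 * n%:R + 1).
have n0 : 0 <= n%:R :> R by rewrite ler0n.
have e0 : 0 < eps by rewrite divr_gt0 //; lra.
have heps : 2 * n%:R * eps < mu.
  have : eps * (2 * n%:R + 1) = mu by rewrite /eps mulfVK // gt_eqF //; lra.
  by lra.
have [q hq] : exists q : 'I_n -> _,
    forall k x, box 2 x -> `|peval (q k) x - F k x| <= eps.
  apply: (@fin_all_exists _ (fun=> _) (fun k q =>
    forall x, box 2 x -> `|peval q x - F k x| <= eps)).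
  by move=> k; apply: weierstrass_box.
have [d [x bx hx]] := perturbed_root q e0.
have [le1|lt1] := leP 1 (\sum_k x 0 k ^+ 2).
  (* At the root, [q_k x_k = - eps x_k^(2d+2) <= 0], so only the approximation error, times
     [|x_k| <= 2], remains. *)
  have : \sum_k F k x * x 0 k <= \sum_(k < n) 2 * eps.
    apply: ler_sum => k _.
    have hk : peval (q k) x * x 0 k <= 0.
      have /eqP := hx k; rewrite addr_eq0 => /eqP ->.
      rewrite mulNr oppr_le0 -mulrA -exprSr mulr_ge0 ?(ltW e0) //.
      by rewrite -doubleS -muln2 exprM sqr_ge0.
    have := hq k x bx; have := bx k; rewrite ler_norml => /andP[? ?] /andP[? ?]; nra.
  have := h2 x (conj bx le1); have : mu <= m2 by rewrite ge_min lexx orbT.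
  by rewrite sumr_const card_ord -[_ *+ n]mulr_natr; lra.
have : \sum_k `|F k x| <= \sum_(k < n) 2 * eps.
  apply: ler_sum => k _.
  have xk : `|x 0 k| <= 1.
    rewrite -(@ler_pXn2r _ 2) ?nnegrE // expr1n real_normK ?num_real // ltW //.
    apply: le_lt_trans lt1; rewrite (bigD1 k) //= lerDl.
    by apply: sumr_ge0 => i _; apply: sqr_ge0.
  have : `|peval (q k) x| <= eps.
    have /eqP := hx k; rewrite addr_eq0 => /eqP ->.
    by rewrite normrN normrM normrX (gtr0_norm e0) ger_pMr // exprn_ile1.
  have := hq k x bx; rewrite !ler_norml => /andP[? ?] /andP[? ?].
  by apply/andP; split; lra.
have := h1 x bx; have : mu <= m1 by rewrite ge_min lexx.
by rewrite sumr_const card_ord -[_ *+ n]mulr_natr; lra.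
Qed.

Lemma coercive_zero (R : realType) n (F : 'I_n -> 'rV[R]_n -> R) (rho : R) :
  0 < rho -> (forall k, continuous (F k)) ->
  (forall x : 'rV[R]_n, rho ^+ 2 <= \sum_k x 0 k ^+ 2 -> 0 < \sum_k F k x * x 0 k) ->
  exists x, forall k, F k x = 0.
Proof.
move=> r0 cF hF.
have [|x hx|x hx] := @coercive_zero_unit R n (fun k x => F k (rho *: x)).
- move=> k x; apply: (continuous_comp (g := F k)); last exact: cF.
  exact: scaler_continuous.
- have := hF (rho *: x); under eq_bigr do rewrite mxE exprMn.
  rewrite -mulr_sumr ler_peMr ?sqr_ge0 // => /(_ isT).
  under eq_bigr do rewrite mxE mulrCA.
  by rewrite -mulr_sumr pmulr_rgt0.
by exists (rho *: x).
Qed.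

(** * The nonlinear system *)

Lemma continuous_row (R : realType) (T : topologicalType) n (f : T -> 'rV[R]_n) :
  (forall j, continuous (fun x => f x 0 j)) -> continuous f.
Proof.
move=> cf x A [P hP hA].
have : \forall y \near x, forall j, P 0 j (f y 0 j).
  by apply: filter_forall => j; apply: (cf j x); apply: hP.
by apply: filterS => y hy; apply: hA => i j; rewrite ord1.
Qed.

(** The factor [max(p, q)] alone may jump. Its product with [d] is [max(pd, qd)] where [d >= 0] and
    [min(pd, qd)] where [d <= 0]; since [pd] and [qd] have the sign of [d], truncating both at 0 and
    adding covers the two cases. *)
Lemma continuous_max_mul (R : realType) (T : topologicalType) (p q d : T -> R) :
  (forall x, 0 <= p x) -> (forall x, 0 <= q x) ->
  continuous (fun x => p x * d x) -> continuous (fun x => q x * d x) ->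
  continuous (fun x => Num.max (p x) (q x) * d x).
Proof.
move=> p0 q0 cp cq.
have -> : (fun x => Num.max (p x) (q x) * d x) =
  (fun x => Num.max 0 (Num.max (p x * d x) (q x * d x)) +
            Num.min 0 (Num.min (p x * d x) (q x * d x))).
  apply/funext => x; have := p0 x; have := q0 x => hq hp.
  have [d0|/ltW d0] := leP 0 (d x).
    rewrite maxr_pMl // [Num.max 0 _]max_r ?[Num.min 0 _]min_l ?addr0 //.
      by rewrite le_min !mulr_ge0.
    by rewrite le_max mulr_ge0.
  rewrite maxr_nMl // [Num.max 0 _]max_l ?[Num.min 0 _]min_r ?add0r //.
    by rewrite ge_min mulr_ge0_le0.
  by rewrite ge_max !mulr_ge0_le0.
pose P x := p x * d x; pose Q x := q x * d x.
have cmax x : {for x, continuous (cst 0 \max (P \max Q))}.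
  have h : {for x, continuous (P \max Q)} by apply: continuous_max; [exact: cp|exact: cq].
  by apply: continuous_max; [exact: cst_continuous|exact: h].
have cmin x : {for x, continuous (cst 0 \min (P \min Q))}.
  have h : {for x, continuous (P \min Q)} by apply: continuous_min; [exact: cp|exact: cq].
  by apply: continuous_min; [exact: cst_continuous|exact: h].
by move=> x; exact: (continuousD (cmax x) (cmin x)).
Qed.

(** * Symmetry, bounds and continuity of the coefficients [b_ij] *)

Section Coefficients.
Variables (R : realType) (N : nat) (a : 'M[R]_N).
Variable (beta : 'I_N -> 'I_N -> 'rV[R]_N -> R).
Hypothesis hbeta01 : forall i j U, 0 <= beta i j U <= 1.
Implicit Types (i j : 'I_N) (U : 'rV[R]_N).

Lemma b_offdiagC U i j : b_offdiag a beta U i j = b_offdiag a beta U j i.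
Proof. by rewrite /b_offdiag maxCA [in RHS]maxCA (maxC (beta i j U * a i j)). Qed.

Lemma b_offdiag_le0 U i j : b_offdiag a beta U i j <= 0.
Proof. by rewrite oppr_le0 !le_max lexx orbT. Qed.

Lemma b_offdiag_norm U i j : `|b_offdiag a beta U i j| <= `|a i j| + `|a j i|.
Proof.
have h k l : beta k l U * a k l <= `|a k l|.
  apply: (le_trans (ler_norm _)); rewrite normrM ler_piMl //.
  by have /andP[h0 h1] := hbeta01 k l U; rewrite ger0_norm.
rewrite normrN ger0_norm ?le_max ?lexx ?orbT // !ge_max addr_ge0 //=.
by rewrite (le_trans (h i j)) ?lerDl // (le_trans (h j i)) ?lerDr.
Qed.

(** The rows of [b_coef] sum to zero. The difference form is the one whose terms are continuous. *)
Lemma b_coef_sum U i :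
  \sum_j b_coef a beta U i j * U 0 j =
  \sum_j b_offdiag a beta U i j * (U 0 j - U 0 i).
Proof.
rewrite (bigD1 i) //= [RHS](bigD1 i) //= subrr mulr0 add0r /b_coef eqxx.
rewrite mulNr mulr_suml addrC -sumrB; apply: eq_bigr => j /negPf ji.
by rewrite eq_sym ji mulrBr.
Qed.

Hypothesis hbeta : forall i j, 0 < a i j ->
  continuous (fun U : 'rV[R]_N => beta i j U * (U 0 j - U 0 i)).

(** The triple maximum is the maximum of two nonnegative parts. A part with [a k l <= 0] vanishes;
    otherwise it is [a k l * beta k l], whose product with the difference is continuous by
    hypothesis. *)
Lemma b_offdiag_continuous i j :
  continuous (fun U : 'rV[R]_N => b_offdiag a beta U i j * (U 0 j - U 0 i)).
Proof.
have h k l : continuous (fun U : 'rV[R]_N =>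
    Num.max 0 (beta k l U * a k l) * (U 0 l - U 0 k)).
  have [akl|akl] := leP (a k l) 0.
    have -> : (fun U : 'rV[R]_N =>
        Num.max 0 (beta k l U * a k l) * (U 0 l - U 0 k)) = cst 0.
      apply/funext => U; rewrite max_l ?mul0r // mulr_ge0_le0 //.
      by have /andP[] := hbeta01 k l U.
    exact: cst_continuous.
  have -> : (fun U : 'rV[R]_N => Num.max 0 (beta k l U * a k l) * (U 0 l - U 0 k)) =
      (fun U => a k l * (beta k l U * (U 0 l - U 0 k))).
    apply/funext => U; rewrite max_r; first by rewrite mulrAC mulrC.
    by rewrite mulr_ge0 ?(ltW akl) //; have /andP[] := hbeta01 k l U.
  have hb := hbeta akl.
  by move=> U; exact: (continuousM (@cst_continuous _ _ (a k l) U) (hb U)).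
have -> : (fun U : 'rV[R]_N => b_offdiag a beta U i j * (U 0 j - U 0 i)) =
  (fun U => - (Num.max (Num.max 0 (beta i j U * a i j)) (Num.max 0 (beta j i U * a j i))
            * (U 0 j - U 0 i))).
  apply/funext => U; rewrite /b_offdiag mulNr; congr (- (_ * _)).
  by rewrite maxACA maxxx maxCA.
have h' : continuous (fun U : 'rV[R]_N =>
    Num.max 0 (beta j i U * a j i) * (U 0 j - U 0 i)).
  have -> : (fun U : 'rV[R]_N => Num.max 0 (beta j i U * a j i) * (U 0 j - U 0 i)) =
      (fun U => - (Num.max 0 (beta j i U * a j i) * (U 0 i - U 0 j))).
    by apply/funext => U; rewrite -mulrN opprB.
  by move=> U; exact: (continuousN (h j i U)).
have hmax := continuous_max_mul _ _ (h i j) h'.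
by move=> U; apply: (continuousN (hmax _ _ U)) => V; rewrite le_max lexx.
Qed.

Lemma b_coef_continuous i j :
  continuous (fun U : 'rV[R]_N => b_coef a beta U i j * (U 0 j - U 0 i)).
Proof.
rewrite /b_coef; case: eqVneq => [<-|_]; last exact: b_offdiag_continuous.
by under eq_fun do rewrite subrr mulr0; exact: cst_continuous.
Qed.

End Coefficients.

(** Minimum over the compact unit sphere, extended by homogeneity. *)
Lemma posdef_lb (R : realType) n (A : 'I_n -> 'I_n -> R) :
  (forall v : 'rV[R]_n, v != 0 -> 0 < \sum_i \sum_j v 0 i * A i j * v 0 j) ->
  exists2 al, 0 < al & forall v : 'rV[R]_n,
    al * \sum_i v 0 i ^+ 2 <= \sum_i \sum_j v 0 i * A i j * v 0 j.
Proof.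
move=> hA.
have cX k : continuous (fun x : 'rV[R]_n => x 0 k) by move=> x; apply: coord_continuous.
have cN : continuous (fun x : 'rV[R]_n => \sum_k x 0 k ^+ 2).
  by apply: continuous_sum_fun => k x; exact: (continuousM (cX k x) (cX k x)).
have [||v [_ /= hv]|al al0 hal] := @compact_pos_lb R n
    (fun v => \sum_i \sum_j v 0 i * A i j * v 0 j)
    (box 1 `&` [set x | \sum_k x 0 k ^+ 2 = 1])%classic.
- apply: compact_closedI; first exact: box_compact.
  apply: (@closed_comp _ _ (fun x : 'rV[R]_n => \sum_k x 0 k ^+ 2)
    [set y | y = 1]%classic).
    by move=> x _; apply: cN.
  exact: closed_eq.
- apply: continuous_sum_fun => i; apply: continuous_sum_fun => j x.
  apply: continuousM (cX j x); apply: continuousM (cX i x) _; exact: cst_continuous.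
- apply: hA; apply/eqP => v0; move: hv; rewrite v0 big1 => [/eqP|k _].
    by rewrite eq_sym oner_eq0.
  by rewrite mxE expr0n.
exists al => // v; set s := \sum_i v 0 i ^+ 2.
have s0 : 0 <= s by apply: sumr_ge0 => i _; apply: sqr_ge0.
have [v0|v0] := eqVneq v 0.
  rewrite /s v0 !big1 ?mulr0 // => i _; last by rewrite mxE expr0n.
  by rewrite big1 // => j _; rewrite !mxE mulr0.
have sp : 0 < s.
  rewrite lt_neqAle s0 andbT eq_sym; apply: contra v0.
  rewrite /s psumr_eq0 => [/allP h|i _]; last exact: sqr_ge0.
  apply/eqP/rowP => k; apply/eqP; rewrite mxE -(sqrf_eq0 (v 0 k)).
  by apply: h; rewrite mem_index_enum.
pose t := Num.sqrt s; have t0 : 0 < t by rewrite sqrtr_gt0.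
have ts : t ^+ 2 = s by rewrite sqr_sqrtr.
have hw : \sum_k (t^-1 *: v) 0 k ^+ 2 = 1.
  under eq_bigr do rewrite mxE exprMn.
  by rewrite -mulr_sumr -/s exprVn ts mulVf // gt_eqF.
have wb : box 1 (t^-1 *: v).
  move=> k; rewrite -ler_norml -(@ler_pXn2r _ 2) ?nnegrE // expr1n.
  rewrite real_normK ?num_real // -hw (bigD1 k) //= lerDl.
  by apply: sumr_ge0 => i _; apply: sqr_ge0.
have := hal _ (conj wb hw).
have -> : \sum_i \sum_j (t^-1 *: v) 0 i * A i j * (t^-1 *: v) 0 j =
    s^-1 * \sum_i \sum_j v 0 i * A i j * v 0 j.
  rewrite mulr_sumr; apply: eq_bigr => i _; rewrite mulr_sumr; apply: eq_bigr => j _.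
  by rewrite !mxE -ts; field; rewrite gt_eqF.
by rewrite ler_pdivlMl // mulrC.
Qed.

(** Exchanging [i] and [j] and adding turns twice the sum into that of [- b_ij (v_j - v_i)^2]. *)
Lemma symmetric_diffusion_ge0 (R : realFieldType) n (b : 'I_n -> 'I_n -> R)
    (v : 'I_n -> R) :
  (forall i j, b i j = b j i) -> (forall i j, b i j <= 0) ->
  0 <= \sum_i \sum_j v i * (b i j * (v j - v i)).
Proof.
move=> bC b0; set S := \sum_i _.
have : S + S = \sum_i \sum_j - b i j * (v j - v i) ^+ 2.
  rewrite {2}/S exchange_big /= -big_split; apply: eq_bigr => i _.
  rewrite -big_split; apply: eq_bigr => j _ /=; rewrite (bC j i); ring.
have : 0 <= \sum_i \sum_j - b i j * (v j - v i) ^+ 2.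
  do 2![apply: sumr_ge0 => ? _]; rewrite mulr_ge0 ?sqr_ge0 // oppr_ge0 //.
lra.
Qed.

Lemma sum_ord_split (R : nmodType) M N (h : (M <= N)%N) (f : 'I_N -> R) :
  \sum_j f j = \sum_(i < M) f (widen_ord h i) + \sum_(j < N | (M <= j)%N) f j.
Proof.
rewrite (bigID (fun j : 'I_N => (j < M)%N)) /= big_ord_narrow; congr (_ + _).
by apply: eq_bigl => j; rewrite -leqNgt.
Qed.

Section Extension.
Variables (R : realType) (M N : nat) (h : (M <= N)%N) (c : 'I_N -> R).

Definition extend_row (v : 'rV[R]_M) : 'rV[R]_N :=
  \row_j (if insub (val j) is Some i then v 0 i else c j).

Lemma extend_row_widen v i : extend_row v 0 (widen_ord h i) = v 0 i.
Proof. by rewrite mxE /= valK. Qed.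

Lemma extend_row_ge v (j : 'I_N) : (M <= j)%N -> extend_row v 0 j = c j.
Proof. by move=> Mj; rewrite mxE insubN // -leqNgt. Qed.

Lemma extend_row_continuous : continuous extend_row.
Proof.
apply: continuous_row => j; have [Mj|jM] := leqP M j.
  under eq_fun do rewrite extend_row_ge //.
  exact: cst_continuous.
have -> : j = widen_ord h (Ordinal jM) by apply: val_inj.
under eq_fun do rewrite extend_row_widen.
by move=> x; apply: coord_continuous.
Qed.

End Extension.

(** * Coercivity of the system and existence of a solution *)

Section Existence.
Variables (R : realType) (M N : nat) (hMN : (M <= N)%N) (a : 'M[R]_N).
Variables (g : 'I_M -> R) (c : 'I_N -> R).
Variable (beta : 'I_N -> 'I_N -> 'rV[R]_N -> R).
Hypothesis ha : forall v : 'rV[R]_M, v != 0 ->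
  0 < \sum_(i < M) \sum_(j < M)
        v 0 i * a (widen_ord hMN i) (widen_ord hMN j) * v 0 j.
Hypothesis hbeta01 : forall i j U, 0 <= beta i j U <= 1.
Hypothesis hbeta : forall i j : 'I_N, 0 < a i j ->
  continuous (fun U : 'rV[R]_N => beta i j U * (U 0 j - U 0 i)).

Local Notation w := (widen_ord hMN).
Local Notation ext := (extend_row c).

(** Residual of the [i]-th equation, with [b] in difference form. *)
Let F (i : 'I_M) (v : 'rV[R]_M) : R :=
  \sum_j a (w i) j * ext v 0 j +
  \sum_j b_offdiag a beta (ext v) (w i) j * (ext v 0 j - ext v 0 (w i)) - g i.

Let F_continuous i : continuous (F i).
Proof.
have cE : continuous ext := @extend_row_continuous R M N hMN c.
have cext j : continuous (fun v : 'rV[R]_M => ext v 0 j).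
  have cX : continuous (fun U : 'rV[R]_N => U 0 j) by move=> U; apply: coord_continuous.
  by move=> v; exact: (continuous_comp (cE v) (cX (ext v))).
have c1 : continuous (fun v : 'rV[R]_M => \sum_j a (w i) j * ext v 0 j).
  apply: continuous_sum_fun => j v.
  exact: (continuousM (@cst_continuous _ _ (a (w i) j) v) (cext j v)).
have c2 : continuous (fun v : 'rV[R]_M => \sum_j b_offdiag a beta (ext v) (w i) j *
    (ext v 0 j - ext v 0 (w i))).
  apply: continuous_sum_fun => j v.
  have cb := @b_offdiag_continuous R N a beta hbeta01 hbeta (w i) j.
  exact: (continuous_comp (cE v) (cb (ext v))).
move=> v.
exact: (continuousB (continuousD (c1 v) (c2 v)) (@cst_continuous _ _ (g i) v)).
Qed.

Let K (i : 'I_M) : R :=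
  `|\sum_(j < N | (M <= j)%N) a (w i) j * c j - g i| +
  \sum_(j < N | (M <= j)%N) (`|a (w i) j| + `|a j (w i)|) * `|c j|.

(** Sums are split at [M]. The interior [b] terms are nonnegative in total by symmetry; the boundary
    and data terms cost at most [K i * |v_i|]. *)
Let F_lb (v : 'rV[R]_M) :
  \sum_i \sum_j v 0 i * a (w i) (w j) * v 0 j - \sum_i K i * `|v 0 i| <=
  \sum_i F i v * v 0 i.
Proof.
pose b i j := b_offdiag a beta (ext v) (w i) (w j).
have hS : 0 <= \sum_i \sum_j v 0 i * (b i j * (v 0 j - v 0 i)).
  apply: symmetric_diffusion_ge0 => [i j|i j]; first exact: b_offdiagC.
  exact: b_offdiag_le0.
apply: (@le_trans _ _ (\sum_i \sum_j v 0 i * a (w i) (w j) * v 0 j -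
   \sum_i K i * `|v 0 i| +
   \sum_i \sum_j v 0 i * (b i j * (v 0 j - v 0 i)))); first by rewrite lerDl.
rewrite -sumrB -big_split; apply: ler_sum => i _ /=.
pose x := v 0 i.
pose A1 := \sum_j a (w i) (w j) * v 0 j.
pose A2 := \sum_(j < N | (M <= j)%N) a (w i) j * c j.
pose B1 := \sum_j b i j * (v 0 j - v 0 i).
pose B2 := \sum_(j < N | (M <= j)%N) b_offdiag a beta (ext v) (w i) j * (c j - x).
have -> : F i v = A1 + A2 + (B1 + B2) - g i.
  rewrite /F !(sum_ord_split hMN) extend_row_widen; congr (_ + _ + (_ + _) - _).
  - by apply: eq_bigr => j _; rewrite extend_row_widen.
  - by apply: eq_bigr => j Mj; rewrite extend_row_ge.
  - by apply: eq_bigr => j _; rewrite extend_row_widen.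
  - by apply: eq_bigr => j Mj; rewrite extend_row_ge.
have -> : \sum_j v 0 i * a (w i) (w j) * v 0 j = x * A1.
  by rewrite mulr_sumr; apply: eq_bigr => j _; rewrite mulrA.
rewrite -mulr_sumr -/B1 -/x.
have hB2 :
    - (\sum_(j < N | (M <= j)%N) (`|a (w i) j| + `|a j (w i)|) * `|c j|) * `|x| <=
    B2 * x.
  rewrite mulNr !mulr_suml -sumrN; apply: ler_sum => j _.
  have b0 := b_offdiag_le0 a beta (ext v) (w i) j.
  have bn := b_offdiag_norm a hbeta01 (ext v) (w i) j.
  set bb := b_offdiag _ _ _ _ _ in b0 bn *.
  (* In [bb (c_j - x) x] the part [- bb x^2] is nonnegative, so only [bb c_j x] needs a bound. *)
  have h1 : - (bb * c j * x) <= (`|a (w i) j| + `|a j (w i)|) * `|c j| * `|x|.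
    rewrite (le_trans (ler_norm _)) // normrN !normrM.
    by do 2![apply: ler_wpM2r => //].
  have := sqr_ge0 x; nra.
have hA2 : - `|A2 - g i| * `|x| <= (A2 - g i) * x.
  by rewrite mulNr -normrM lerNl -normrN ler_norm.
rewrite /K -/A2; move: hB2 hA2; set sc := \sum_(j < N | _) _; set u := `|A2 - g i|; lra.
Qed.

Lemma nonlinear_system_solvable : exists v : 'rV[R]_M, forall i : 'I_M,
  \sum_(j < N) (a (w i) j + b_coef a beta (ext v) (w i) j) * ext v 0 j = g i.
Proof.
have [al al0 hal] := posdef_lb ha.
have K0 i : 0 <= K i.
  by rewrite addr_ge0 // sumr_ge0 // => j _; rewrite mulr_ge0 // addr_ge0.
pose C := \sum_i K i.
have C0 : 0 <= C by apply: sumr_ge0 => i _; apply: K0.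
(* For a norm [t >= C/al + 1] one has [al t^2 - C t >= al t > 0], which is the required
   coercivity. *)
have r0 : 0 < C / al + 1 by rewrite ltr_wpDl // divr_ge0 // ltW.
have [|v hv] := coercive_zero r0 F_continuous.
  move=> v; set s := \sum_k _; move=> hs; apply: lt_le_trans (F_lb v).
  have s0 : 0 < s by apply: lt_le_trans hs; rewrite exprn_gt0.
  pose t := Num.sqrt s; have t0 : 0 < t by rewrite sqrtr_gt0.
  have ts : t ^+ 2 = s by rewrite sqr_sqrtr // ltW.
  have ht : C / al + 1 <= t by rewrite -(@ler_pXn2r _ 2) ?nnegrE ?ts // ltW.
  have hC : C + al <= al * t.
    have : al * (C / al + 1) <= al * t by rewrite ler_pM2l.
    by rewrite mulrDr mulrCA divff ?mulr1 // gt_eqF.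
  have hK : \sum_i K i * `|v 0 i| <= C * t.
    rewrite /C mulr_suml; apply: ler_sum => i _; apply: ler_wpM2l => //.
    rewrite -(@ler_pXn2r _ 2) ?nnegrE ?(ltW t0) // real_normK ?num_real // ts.
    by rewrite /s (bigD1 i) //= lerDl; apply: sumr_ge0 => k _; apply: sqr_ge0.
  have := hal v; rewrite -/s -ts => hq.
  have : 0 < al * t by rewrite mulr_gt0.
  nra.
exists v => i; under eq_bigr do rewrite mulrDl.
rewrite big_split /= b_coef_sum; apply/eqP; rewrite -subr_eq0; apply/eqP.
exact: hv.
Qed.

End Existence.

Theorem theorem5 (R : realType) (M N : nat) (hM : (0 < M)%N) (hMN : (M < N)%N)
    (a : 'M[R]_N) (g : 'I_M -> R) (ub : {i : 'I_N | (M <= i)%N} -> R)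
    (ha : forall v : 'rV[R]_M, v != 0 ->
      0 < \sum_(i < M) \sum_(j < M)
            v 0 i * a (widen_ord (ltnW hMN) i) (widen_ord (ltnW hMN) j) * v 0 j)
    (beta : 'I_N -> 'I_N -> 'rV[R]_N -> R)
    (hbeta01 : forall i j U, 0 <= beta i j U <= 1)
    (hbeta : forall i j : 'I_N, 0 < a i j ->
      continuous (fun U : 'rV[R]_N => beta i j U * (U 0 j - U 0 i))) :
  [/\ forall i j : 'I_N, (i < M)%N ->
        continuous (fun U : 'rV[R]_N => b_coef a beta U i j * (U 0 j - U 0 i)),
      forall i j : 'I_N, (i < M)%N -> (M <= j)%N ->
        bounded_fun (fun U : 'rV[R]_N => b_coef a beta U i j)
    & exists U : 'rV[R]_N,
        (forall i : 'I_M,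
           \sum_(j < N) (a (widen_ord (ltnW hMN) i) j
                         + b_coef a beta U (widen_ord (ltnW hMN) i) j) * U 0 j = g i) /\
        (forall i : {i : 'I_N | (M <= i)%N}, U 0 (sval i) = ub i)].
Proof.
split=> [i j _|i j iM Mj|]; first exact: b_coef_continuous.
  rewrite /=; apply: filterS (nbhs_pinfty_ge (num_real (`|a i j| + `|a j i|))).
  move=> m hm U _; apply: le_trans hm; rewrite /b_coef ifF; first exact: b_offdiag_norm.
  by apply/eqP => ij; move: iM; rewrite ij ltnNge Mj.
(* The default 0 fills only the indices below [M], where [extend_row] takes the entries of [v]. *)
pose c (j : 'I_N) : R := if insub j is Some k then ub k else 0.
have [v hv] := nonlinear_system_solvable g c ha hbeta01 hbeta.
exists (extend_row c v); split=> // i.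
by rewrite (extend_row_ge _ _ (svalP i)) /c valK.
Qed.
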